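(* Let $\mathcal{F}$ be a periodic infinite frieze of positive integers that is realisable in an annulus but not in a punctured disc, and let $(s_k)_{k\ge0}$ be its growth coefficients. Then $s_k>2$ for all $k>0$.
   Context: An infinite frieze of positive integers is an array $(m_{i,j})$, indexed by $i\in\mathbb{Z}$ and $j\ge i-2$, with $m_{i,i-2}=0$, $m_{i,i-1}=1$, with $m_{i,j}$ a positive integer for $j\ge i-1$, and with $m_{i,j}m_{i+1,j+1}-m_{i,j+1}m_{i+1,j}=1$ for all $i$ and all $j\ge i-1$. It is periodic if for some $n\ge1$ one has $m_{i+n,j+n}=m_{i,j}$ for all entries. With $n$ the minimal such period, the growth coefficients are $s_0:=2$ and $s_k:=m_{1,kn}-m_{2,kn-1}$ for $k\ge1$. The quiddity row is $a_i=m_{i,i}$; a finite block of consecutive entries whose periodic repetition is the quiddity row is called a quiddity sequence of the frieze (its length is a period, not necessarily minimal). Triangulations: consider either an annulus with at least one marked point on each boundary component, or a once-punctured disc with at least one marked point on its boundary (the puncture also being allowed as an endpoint of arcs). A triangulation is a maximal collection of pairwise non-crossing (non-self-crossing) arcs, up to isotopy, with endpoints at marked points (or the puncture), none contractible or isotopic to a boundary segment; loops are allowed. For a chosen boundary component with marked points $1,\dots,N$ in cyclic order it gives the sequence $(a_1,\dots,a_N)$, where $a_i$ is the number of regions incident with the marked point $i$, counted in a small neighbourhood of it (i.e. one plus the number of ends of arcs at $i$). A periodic infinite frieze of positive integers is realisable in an annulus (respectively in a punctured disc) if it has a quiddity sequence obtained in this way from a triangulation of an annulus (respectively of a punctured disc).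 *)

(* Defs.v *)
From HB Require Import structures.
From mathcomp Require Import all_boot all_order all_algebra.

Set Implicit Arguments.
Unset Strict Implicit.
Unset Printing Implicit Defensive.

Import Order.TTheory GRing.Theory Num.Theory.
Local Open Scope ring_scope.

(* A frieze is stored as a total function of (i, j); only the entries with
   j >= i - 2 are meaningful, the other values are arbitrary and never read. *)
Definition infinite_frieze (m : int -> int -> int) : Prop :=
  [/\ forall i, m i (i - 2) = 0,
      forall i, m i (i - 1) = 1,
      forall i j, i - 1 <= j -> 0 < m i j
    & forall i j, i - 1 <= j ->
        m i j * m (i + 1) (j + 1) - m i (j + 1) * m (i + 1) j = 1].

Definition has_period (m : int -> int -> int) (n : nat) : Prop :=
  (0 < n)%N /\ forall i j, i - 2 <= j -> m (i + n%:Z) (j + n%:Z) = m i j.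

Definition is_minimal_period (m : int -> int -> int) (n : nat) : Prop :=
  has_period m n /\ forall p, has_period m p -> (n <= p)%N.

Definition growth_coefficient (m : int -> int -> int) (n k : nat) : int :=
  if k is 0%N then 2 else m 1 (k * n)%:Z - m 2 ((k * n)%:Z - 1).

Definition quiddity_sequence (m : int -> int -> int) (q : seq nat) : Prop :=
  (0 < size q)%N /\
  exists c : int, forall i : int,
    m i i = (nth 0%N q `|((i - c) %% (size q)%:Z)%Z|%N)%:Z.

(* Arcs up to isotopy are recorded through their lifts to a universal cover
   (of the annulus, or of the disc minus its puncture).  The cover is a disc
   with the lifted marked points (and the puncture) on its boundary circle, so
   the isotopy class of a lifted arc is the unordered pair of its endpoints:
   - [lbefore] is the linear order obtained by cutting the boundary circle of
     the cover open;
   - [ldeck k] is the action of the k-th power of the generating deck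
     transformation, so that the arcs of the surface are the [ldeck]-orbits of
     the lifted ones;
   - [lsegment v w] says that v and w are the ends of a lifted boundary
     segment. *)
Record lifted_surface := LiftedSurface {
  lpoint : eqType;
  lbefore : rel lpoint;
  ldeck : int -> lpoint -> lpoint;
  lsegment : rel lpoint }.

Section Triangulations.

Variable S : lifted_surface.
Implicit Types (v w x y : lpoint S) (T : rel (lpoint S)).

Definition between v w x : bool :=
  (lbefore v x && lbefore x w) || (lbefore w x && lbefore x v).

(* Two curves in a disc with endpoints {v, w} and {x, y} on its boundary must
   cross exactly when {v, w} separates x from y on the boundary circle; curves
   sharing an endpoint can be made disjoint in their interiors. *)
Definition crossing v w x y : bool :=
  [&& x \notin [:: v; w], y \notin [:: v; w] & between v w x != between v w y].

(* [v != w] excludes the contractible curves: a loop of the surface that goes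
   once around the annulus or the puncture lifts to a curve with distinct ends.
   The last clause says that the arc does not cross itself, i.e. that its lifts
   do not cross one another. *)
Definition is_arc v w : Prop :=
  [/\ v != w, ~~ lsegment v w
    & forall k, ~~ crossing v w (ldeck k v) (ldeck k w)].

(* A collection of arcs of the surface, given by all the lifts of its members:
   [T v w] means that the arc with a lift joining v and w belongs to it. *)
Definition noncrossing_arcs T : Prop :=
  [/\ symmetric T,
      forall k v w, T (ldeck k v) (ldeck k w) = T v w,
      forall v w, T v w -> is_arc v w
    & forall v w x y, T v w -> T x y -> ~~ crossing v w x y].

Definition triangulation T : Prop :=
  noncrossing_arcs T /\
  forall T', noncrossing_arcs T' -> subrel T T' -> subrel T' T.

(* The ends of arcs at a marked point correspond to the lifted arcs issuing
   from any one lift v of it (the two ends of a loop give two such lifts). *)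
Definition regions_at T v (a : nat) : Prop :=
  exists s : seq (lpoint S),
    [/\ uniq s, forall w, (w \in s) = T v w & a = (size s).+1].

End Triangulations.

(* The cover of an annulus is a strip, with one boundary line for each boundary
   component b : bool; [(b, i)] is the i-th lifted marked point on line b, both
   lines being numbered from left to right, and [p b] is the number of marked
   points on component b.  Going around the strip, one line is traversed
   rightwards and then the other one leftwards. *)
Definition annulus (p : bool -> nat) : lifted_surface :=
  @LiftedSurface (bool * int)%type
    (fun v w => match v.1, w.1 with
                | false, false => v.2 < w.2
                | false, true => true
                | true, false => false
                | true, true => w.2 < v.2
                end)
    (fun k v => (v.1, v.2 + k * (p v.1)%:Z))
    (fun v w => (v.1 == w.1) && (`|v.2 - w.2| == 1)).

(* The cover of the disc minus its puncture is a half-plane; [Some i] is the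
   i-th lifted marked point on its boundary line, and the puncture [None] is
   the point at infinity, fixed by the deck transformations.  A simple loop
   based at the puncture is contractible, in accordance with [is_arc]. *)
Definition punctured_disc (p : nat) : lifted_surface :=
  @LiftedSurface (option int)
    (fun v w => match v, w with
                | Some i, Some j => i < j
                | Some _, None => true
                | None, _ => false
                end)
    (fun k v => omap (fun i => i + k * p%:Z) v)
    (fun v w => if (v, w) is (Some i, Some j) then `|i - j| == 1 else false).

Definition realisable_in_annulus (m : int -> int -> int) : Prop :=
  exists (p : bool -> nat) (T : rel (lpoint (annulus p))) (b : bool)
         (q : seq nat),
    [/\ forall c, (0 < p c)%N, triangulation T, size q = p b,
        forall i : nat, (i < p b)%N ->
          regions_at T ((b, i%:Z) : lpoint (annulus p)) (nth 0%N q i)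
      & quiddity_sequence m q].

Definition realisable_in_punctured_disc (m : int -> int -> int) : Prop :=
  exists (p : nat) (T : rel (lpoint (punctured_disc p))) (q : seq nat),
    [/\ (0 < p)%N, triangulation T, size q = p,
        forall i : nat, (i < p)%N ->
          regions_at T (Some i%:Z : lpoint (punctured_disc p)) (nth 0%N q i)
      & quiddity_sequence m q].

(* Main.v *)
(* The quiddity row is read as a three-term recurrence for vectors [v_i] of Z^2
   with [m i j = det (v_(i-1), v_(j+1))].  For [p = k n] the growth coefficient
   is the trace of the monodromy matrix taking [v_i] to [v_(i+p)], and
   positivity of the entries excludes traces below 2.  If the trace is 2, the
   monodromy fixes a primitive vector [w] with [det (v_i, w) > 0] for all [i].
   Sending the lifted marked points to the [v_i] and the puncture to [w], the
   pairs with determinant 1 are edges of the Farey graph.  They do not cross, by the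
   Pluecker relation, and at [v_i] they are exactly the vectors
   [v_(i+1) - t v_i] with [0 < t < a_i], up to sign: these fans show that the
   edges triangulate the punctured disc and have quiddity row [a]. *)
Require Import Defs.
From mathcomp Require Import all_boot all_order all_algebra.
From mathcomp Require Import zify ring.

Set Implicit Arguments.
Unset Strict Implicit.
Unset Printing Implicit Defensive.

Import Order.TTheory GRing.Theory Num.Theory.
Local Open Scope ring_scope.

(** * Determinants and primitive vectors in the integer plane *)

Definition det (u w : int * int) : int := u.1 * w.2 - u.2 * w.1.

Lemma detC u w : det u w = - det w u.
Proof. by rewrite /det; ring. Qed.

Lemma det_self u : det u u = 0.
Proof. by rewrite /det mulrC subrr. Qed.

Lemma plucker a b c d :
  det a c * det b d = det a b * det c d + det a d * det b c.
Proof. by rewrite /det; ring. Qed.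

Lemma det_inj a b u w :
  det a b = 1 -> det a u = det a w -> det b u = det b w -> u = w.
Proof.
move=> ab au bu.
(* Cramer's rule in the basis [a], [b]. *)
have E z : z = (det a z * b.1 - det b z * a.1, det a z * b.2 - det b z * a.2).
  rewrite [LHS]surjective_pairing.
  have -> : z.1 = det a b * z.1 by rewrite ab mul1r.
  have -> : z.2 = det a b * z.2 by rewrite ab mul1r.
  by rewrite /det /=; congr pair; ring.
by rewrite (E u) (E w) au bu.
Qed.

Definition primitive (u : int * int) := exists c, det u c = 1.

(** A complement [c] of [z] turns the Pluecker relation into [det b z * det u c = 1], so [det b z]
    is 1 and both vectors have the same determinants against the basis [b], [u]. *)
Lemma primitive_parallel b u z :
  det b u = 1 -> 0 < det b z -> det u z = 0 -> primitive z -> z = u.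
Proof.
move=> bu bz uz [c zc].
have D1 : det b z = 1.
  have := plucker b u z c; rewrite bu uz zc mulr0 addr0 mul1r.
  move: (det b z) (det u c) bz => D e D0 De.
  have e0 : 0 < e by nia.
  nia.
apply: (det_inj bu); first by rewrite D1 bu.
by rewrite uz detC; rewrite /det; ring.
Qed.

(* Two edges of the Farey graph never cross: a unimodular path [z] that leaves
   [u] on one side and reaches the other side must pass through [u]. *)
Lemma path_through (z : nat -> int * int) b u K :
  (forall k, det (z k) (z k.+1) = 1) -> (forall k, 0 < det b (z k)) ->
  det b u = 1 -> det u (z 0%N) <= 0 -> 0 <= det u (z K) ->
  exists k, z k = u.
Proof.
move=> zz bz bu u0 uK.
have par k : det u (z k) = 0 -> exists k, z k = u.
  move=> uz; exists k; apply: (primitive_parallel bu (bz k) uz).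
  by exists (z k.+1).
elim: K uK => [|K IH] uK; first by apply: (par 0%N); lia.
have [/IH //|uK0] := leP 0 (det u (z K)).
have [uS|uS] := eqVneq (det u (z K.+1)) 0; first exact: par uS.
(* A strict sign change would make 1 a sum of two products of positive integers. *)
have := plucker b (z K) u (z K.+1); rewrite zz bu (detC (z K) u).
have := bz K; have := bz K.+1.
move: (det u (z K.+1)) (det u (z K)) (det b (z K)) (det b (z K.+1)) uS uK0 uK.
by move=> p q r s; nia.
Qed.

(** * The Farey triangulation of a parabolic frame *)

Section ParabolicFrame.

Variables (v : int -> int * int) (w : int * int) (a : int -> int) (p : nat).
Hypothesis v_rec : forall (i : int) u,
  det (v (i + 1)) u = a i * det (v i) u - det (v (i - 1)) u.
Hypothesis v_pos : forall i j : int, i < j -> 0 < det (v i) (v j).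
Hypothesis v_succ : forall i, det (v i) (v (i + 1)) = 1.
Hypothesis w_pos : forall i, 0 < det (v i) w.
Hypothesis w_prim : primitive w.
Hypothesis v_per : forall i j k : int,
  det (v (i + k * p%:Z)) (v (j + k * p%:Z)) = det (v i) (v j).
Hypothesis w_per : forall i k : int, det (v (i + k * p%:Z)) w = det (v i) w.
(** Discrete form of the fact that the direction of [v j] tends to that of [w] on the right and to
    that of [- w] on the left. *)
Hypothesis v_right : forall u (i : int),
  0 < det u w -> exists2 j : int, i < j & 0 <= det u (v j).
Hypothesis v_left : forall u (i : int),
  0 < det u w -> exists2 j : int, j < i & det u (v j) <= 0.

Notation pt := (lpoint (punctured_disc p)).

Definition vec (x : pt) : int * int := oapp v w x.

(** Consecutive [v i] also have determinant 1, so boundary segments are removed by hand. *)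
Definition farey_arcs : rel pt :=
  fun x y => (`|det (vec x) (vec y)| == 1) && ~~ lsegment x y.

Lemma det_vec_gt0 (x y : pt) : lbefore x y -> 0 < det (vec x) (vec y).
Proof. by case: x y => [i|] [j|] //=; apply: v_pos. Qed.

Lemma lbefore_total (x y : pt) : x != y -> lbefore x y || lbefore y x.
Proof. by case: x y => [i|] [j|] //=; rewrite neq_lt. Qed.

Lemma lbefore_det (x y : pt) : lbefore x y = (0 < det (vec x) (vec y)).
Proof.
apply/idP/idP; first exact: det_vec_gt0.
have [->|] := eqVneq x y; first by rewrite det_self.
move=> /lbefore_total /orP[// | /det_vec_gt0]; rewrite detC; lia.
Qed.

(** * Farey arcs do not cross *)

Lemma farey_arcsC : symmetric farey_arcs.
Proof.
move=> x y; rewrite /farey_arcs detC normrN; congr (_ && ~~ _).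
by case: x y => [i|] [j|] //=; rewrite distrC.
Qed.

(** For interlaced ends, the Pluecker relation writes the product 1 of the two arc determinants as a
    sum of two positive products. *)
Lemma farey_arcs_disjoint (x y x' y' : pt) :
  lbefore x x' -> lbefore x' y -> lbefore y y' -> lbefore x y ->
  lbefore x y' -> lbefore x' y' ->
  farey_arcs x y -> farey_arcs x' y' -> False.
Proof.
rewrite !lbefore_det /farey_arcs => h1 h2 h3 h4 h5 h6.
case/andP=> [/eqP e1 _] /andP[/eqP e2 _].
have := plucker (vec x) (vec x') (vec y) (vec y').
rewrite !gtr0_norm // in e1 e2; rewrite e1 e2.
move: h1 h2 h3 h5.
move: (det (vec x) (vec x')) (det (vec x') (vec y)) => A B.
move: (det (vec y) (vec y')) (det (vec x) (vec y')) => C D.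
nia.
Qed.

Lemma lbefore_trans (x y z : pt) : lbefore x y -> lbefore y z -> lbefore x z.
Proof. by case: x y z => [i|] [j|] [k|] //=; apply: lt_trans. Qed.

Lemma crossingCl (x y x' y' : pt) : crossing x y x' y' = crossing y x x' y'.
Proof.
by rewrite /crossing /between !inE ![(lbefore y _ && _) || _]orbC
  ![(_ == y) || _]orbC.
Qed.

Lemma crossingCr (x y x' y' : pt) : crossing x y x' y' = crossing x y y' x'.
Proof. by rewrite /crossing eq_sym andbCA. Qed.

(** Symmetry reduces to [x] before [y] with [x'] between them; then [y'] lies before [x] or after
    [y], and either way the ends interlace. *)
Lemma farey_arcs_noncrossing (x y x' y' : pt) :
  farey_arcs x y -> farey_arcs x' y' -> ~~ crossing x y x' y'.
Proof.
move=> Txy Txy'; apply/negP=> cr.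
have xNy : x != y.
  by apply/eqP=> exy; move: Txy; rewrite exy /farey_arcs det_self normr0.
wlog xy : x y Txy cr xNy / lbefore x y.
  move=> W; have /orP[xy|yx] := lbefore_total xNy; first exact: (W x y).
  by apply: (W y x); rewrite // 1?farey_arcsC 1?crossingCl // eq_sym.
have {xNy} nbyx (z : pt) : ~~ (lbefore y z && lbefore z x).
  apply/negP=> /andP[yz zx]; have := lbefore_trans (lbefore_trans yz zx) xy.
  by rewrite lbefore_det det_self.
wlog bx' : x' y' Txy' cr / between x y x'.
  move=> W; case bx: (between x y x'); first exact: (W x' y').
  apply: (W y' x'); rewrite 1?farey_arcsC 1?crossingCr //.
  by case/and3P: cr => _ _; rewrite bx; case: between.
case/and3P: cr; rewrite !inE !negb_or => _ /andP[y'x y'y].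
rewrite bx' /=; move: bx'; rewrite /between !(negbTE (nbyx _)) !orbF.
case/andP=> xx' x'y ny'.
case/orP: (lbefore_total y'x) => [y'x0|xy'].
  have y'x' := lbefore_trans y'x0 xx'.
  apply: (@farey_arcs_disjoint y' x' x y) => //.
  - exact: lbefore_trans x'y.
  - by rewrite farey_arcsC.
case/orP: (lbefore_total y'y) => [y'y0|yy'].
  by rewrite xy' y'y0 in ny'.
apply: (@farey_arcs_disjoint x y x' y') => //.
exact: lbefore_trans x'y yy'.
Qed.

Lemma farey_arcs_deck k (x y : pt) :
  farey_arcs (ldeck k x) (ldeck k y) = farey_arcs x y.
Proof.
rewrite /farey_arcs; congr ((`|_| == 1) && ~~ _).
  case: x y => [i|] [j|] //=.
  by rewrite detC w_per -detC.
case: x y => [i|] [j|] //=; congr (`|_| == 1); ring.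
Qed.

Lemma noncrossing_farey_arcs : noncrossing_arcs farey_arcs.
Proof.
split; [exact: farey_arcsC | exact: farey_arcs_deck | |
        exact: farey_arcs_noncrossing].
move=> x y Txy; split; last 1 first.
- by move=> k; apply: farey_arcs_noncrossing; rewrite ?farey_arcs_deck.
- by apply/eqP=> exy; move: Txy; rewrite exy /farey_arcs det_self normr0.
by case/andP: Txy.
Qed.

(* The vector of [x], with the sign that makes it lie in the half-plane
   [0 < det (v i) _]. *)
Definition svec i (x : pt) : int * int :=
  if lbefore (Some i : pt) x then vec x else (- (vec x).1, - (vec x).2).

Lemma det_svec u i x :
  det u (svec i x) =
  if lbefore (Some i : pt) x then det u (vec x) else - det u (vec x).
Proof. by rewrite /svec; case: ifP => // _; rewrite /det /=; ring. Qed.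

(** * The fan of Farey neighbours of a marked point *)

Definition fan i (t : int) : int * int :=
  ((v (i + 1)).1 - t * (v i).1, (v (i + 1)).2 - t * (v i).2).

Lemma det_fan u i t : det (fan i t) u = det (v (i + 1)) u - t * det (v i) u.
Proof. by rewrite /det /=; ring. Qed.

Lemma det_fan_succ i t : det (fan i t) (fan i (t + 1)) = 1.
Proof. by rewrite -[RHS](v_succ i) /det /=; ring. Qed.

Lemma det_v_fan i t : det (v i) (fan i t) = 1.
Proof. by rewrite -[RHS](v_succ i) /det /=; ring. Qed.

Lemma det_pred_fan i t : det (v (i - 1)) (fan i t) = a i - t.
Proof.
have E : det (v (i - 1)) (fan i t) = a i * 1 - det (v (i + 1)) (fan i t).
  by rewrite v_rec det_v_fan; ring.
rewrite E [det (v (i + 1)) _]detC det_fan det_self v_succ; ring.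
Qed.

(** The sign of [det (fan i t) w] tells where the point lies: to the right of [i], to the left, or
    at the puncture. *)
Lemma fan_vec i (t : int) :
  0 <= t <= a i -> exists2 x, x != Some i & svec i x = fan i t.
Proof.
case/andP=> t0 ta.
have [h0|h0|h0] := ltgtP 0 (det (fan i t) w).
- have [j ij uj] := v_right i h0.
  pose z k := v (i + 1 + k%:Z).
  have [] := @path_through z (v i) (fan i t) (absz (j - i - 1)%R).
  + move=> k; rewrite /z -[RHS](v_succ (i + 1 + k%:Z)).
    by congr (det _ (v _)); lia.
  + by move=> k; apply: v_pos; lia.
  + exact: det_v_fan.
  + rewrite det_fan /z addr0 det_self v_succ; lia.
  + by rewrite /z; have -> : i + 1 + (absz (j - i - 1)%R)%:Z = j by lia.
  move=> k zk; exists (Some (i + 1 + k%:Z)); first by apply/eqP; case; lia.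
  by rewrite /svec /=; case: ifP => [_|]; [exact: zk | lia].
(* The reflection [r] reverses orientation, so that the leftward path from [v (i - 1)] becomes
   unimodular in the sense of [path_through]. *)
- pose r (u : int * int) := (u.1, - u.2).
  have det_r u u' : det (r u) (r u') = det u' u by rewrite /det /=; ring.
  pose u := (- (fan i t).1, - (fan i t).2).
  have det_u u' : det u u' = - det (fan i t) u' by rewrite /det /=; ring.
  have uw : 0 < det u w by rewrite det_u; lia.
  have [j ji uj] := v_left i uw.
  pose z k := r (v (i - 1 - k%:Z)).
  have [] := @path_through z (r (v i)) (r u) (absz (i - 1 - j)%R).
  + move=> k; rewrite /z det_r -[RHS](v_succ (i - 1 - k.+1%:Z)).
    by congr (det _ (v _)); lia.
  + by move=> k; rewrite det_r; apply: v_pos; lia.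
  + by rewrite det_r det_u detC opprK det_v_fan.
  + rewrite det_r subr0 detC det_u opprK detC det_pred_fan; lia.
  + rewrite det_r detC; have -> : i - 1 - (absz (i - 1 - j)%R)%:Z = j by lia.
    lia.
  move=> k zk; exists (Some (i - 1 - k%:Z)); first by apply/eqP; case; lia.
  rewrite /svec /=; case: ifP => [|_]; first by lia.
  case: zk; rewrite /u [fan i t]surjective_pairing.
  move=> -> /(congr1 -%R); rewrite !opprK => ->; rewrite opprK.
  by rewrite -surjective_pairing.
exists None => //.
by rewrite /svec /=; apply: (primitive_parallel (det_v_fan i t)).
Qed.

Lemma det_v_svec i (x : pt) : det (v i) (svec i x) = `|det (v i) (vec x)|.
Proof.
rewrite det_svec; case: ifPn => [/det_vec_gt0 h|ix]; first by rewrite gtr0_norm.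
have [->|/lbefore_total] := eqVneq x (Some i).
  by rewrite /= det_self oppr0.
rewrite (negbTE ix) orbF => /det_vec_gt0 h.
by rewrite detC opprK normrN gtr0_norm.
Qed.

Lemma svec_gt0 i (x : pt) : x != Some i -> 0 < det (v i) (svec i x).
Proof.
rewrite det_v_svec normr_gt0 => /lbefore_total.
by rewrite !lbefore_det [det (vec x) _]detC oppr_gt0 -neq_lt eq_sym.
Qed.

Lemma det_succ_svec i (x : pt) :
  x != Some i -> ~~ lsegment (Some i : pt) x -> 0 < det (v (i + 1)) (svec i x).
Proof.
rewrite det_svec; case: x => [j|] /= ij; last by rewrite w_pos.
have {}ij : i != j by apply: contra ij => /eqP ->.
case: ifP => lij sij; first by apply: v_pos; lia.
by rewrite -detC; apply: v_pos; lia.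
Qed.

Lemma det_pred_svec i (x : pt) :
  x != Some i -> ~~ lsegment (Some i : pt) x -> 0 < det (v (i - 1)) (svec i x).
Proof.
rewrite det_svec; case: x => [j|] /= ij; last by rewrite w_pos.
have {}ij : i != j by apply: contra ij => /eqP ->.
case: ifP => lij sij; first by apply: v_pos; lia.
by rewrite -detC; apply: v_pos; lia.
Qed.

Lemma lsegment_svec i (x : pt) :
  lsegment (Some i : pt) x ->
  det (v (i + 1)) (svec i x) = 0 \/ det (v (i - 1)) (svec i x) = 0.
Proof.
rewrite !det_svec; case: x => [j|] //= ij.
have [->|->] : j = i + 1 \/ j = i - 1 by lia.
- by left; rewrite det_self oppr0 if_same.
- by right; rewrite det_self oppr0 if_same.
Qed.

Lemma primitive_svec i x : primitive (svec i x).
Proof.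
have [c vc] : primitive (vec x).
  by case: x => [j|] //=; exists (v (j + 1)).
rewrite /svec; case: ifP => _; first by exists c.
by exists (- c.1, - c.2); rewrite -vc /det /=; ring.
Qed.

Lemma norm_det_svec i x y :
  `|det (svec i x) (svec i y)| = `|det (vec x) (vec y)|.
Proof.
rewrite det_svec detC det_svec detC.
by do 2!case: ifP; rewrite ?opprK ?normrN.
Qed.

Lemma svec_inj i (x y : pt) : svec i x = svec i y -> x = y.
Proof.
move=> exy; apply/eqP; apply: contraT => /lbefore_total.
have /eqP : `|det (vec x) (vec y)| = 0.
  by rewrite -(norm_det_svec i) exy det_self.
by rewrite normr_eq0 => /eqP e; rewrite !lbefore_det [det (vec y) _]detC e.
Qed.

(** Seen from [i], the side of the chord to [y] is the sign of a determinant, up to a correction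
    depending on [y] alone; opposite signs thus mean separation by the chord. *)
Lemma between_svec i (x y : pt) :
  x != Some i -> y != Some i -> det (svec i x) (svec i y) != 0 ->
  between (Some i : pt) y x =
  ((0 < det (svec i x) (svec i y)) == lbefore (Some i : pt) y).
Proof.
move=> xi yi.
have := @lbefore_trans x (Some i) y; have := @lbefore_trans y (Some i) x.
have := lbefore_total xi; have := lbefore_total yi.
rewrite det_svec [det (svec i x) _]detC det_svec [det (vec y) (vec x)]detC.
rewrite /between !lbefore_det [det (vec y) (vec x)]detC.
rewrite [det (vec x) (vec (Some i))]detC [det (vec y) (vec (Some i))]detC.
move: (det (vec x) (vec y)) (det _ (vec x)) (det _ (vec y)) => X Y Z.
rewrite !oppr_gt0.
by case: (ltgtP 0 Y) => _; case: (ltgtP 0 Z) => _ // _ _ H1 H2 X0;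
  have [//|X1|X1] := ltgtP 0 X; lia.
Qed.

(** * Maximality and the count of regions *)

Lemma farey_arcs_maximal (T : rel pt) :
  noncrossing_arcs T -> subrel farey_arcs T -> subrel T farey_arcs.
Proof.
case=> TC _ Tarc Tnc sub x y Txy.
(* The ends of an arc differ, so one of them is not the puncture. *)
wlog [i xi] : x y Txy / exists i, x = Some i.
  case: x y Txy => [i|] [j|] Txy W; try by apply: (W _ _ Txy); exists i.
    by rewrite farey_arcsC; apply: W; [rewrite TC | exists j].
  by have [/eqP] := Tarc _ _ Txy.
rewrite {x}xi in Txy *; have [iy sy _] := Tarc _ _ Txy.
rewrite eq_sym in iy; rewrite /farey_arcs sy andbT; apply: contraT => D1.
have D0 := svec_gt0 iy; have e0 := det_succ_svec iy sy.
have := det_pred_svec iy sy.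
have -> : det (v (i - 1)) (svec i y) =
          a i * det (v i) (svec i y) - det (v (i + 1)) (svec i y).
  by rewrite v_rec; ring.
have {}D1 : det (v i) (svec i y) != 1.
  by rewrite det_v_svec.
set D := det (v i) _ in D0 D1 *; set e := det (v (i + 1)) _ in e0 * => aDe.
(* The direction of [svec i y] lies strictly between the consecutive fan vectors
   of indices [t] and [t + 1], so the arc joining their ends separates [i] from
   [y]. *)
pose t := (e %/ D)%Z.
have [eD r0 rD] : [/\ e = t * D + (e %% D)%Z, 0 <= (e %% D)%Z & (e %% D)%Z < D].
  by split; [exact: divz_eq | apply: modz_ge0; lia | apply: ltz_pmod].
(* Positivity of [e] and of [a i * D - e] keeps both indices within the fan. *)
have t0 : 0 <= t by nia.
have ta : t < a i by nia.
have [x1 x1i s1] : exists2 x, x != Some i & svec i x = fan i t.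
  by apply: fan_vec; lia.
have [x2 x2i s2] : exists2 x, x != Some i & svec i x = fan i (t + 1).
  by apply: fan_vec; lia.
have e1 : 0 < det (svec i x1) (svec i y).
  rewrite s1 lt_neqAle eq_sym; apply/andP; split; last first.
    by rewrite det_fan -/e -/D; lia.
  (* If the determinant vanished, primitivity would identify [svec i y] with [fan i t] and force
     [D = 1]. *)
  apply: contra D1 => /eqP /(primitive_parallel (det_v_fan i t) D0) E.
  by rewrite /D E ?det_v_fan //; apply: primitive_svec.
have e2 : det (svec i x2) (svec i y) < 0.
  by rewrite s2 det_fan -/e -/D; nia.
have cr : crossing (Some i : pt) y x1 x2.
  rewrite /crossing !inE !negb_or x1i x2i.
  rewrite !between_svec ?(gt_eqF e1) ?(lt_eqF e2) //.
  rewrite e1 [0 < det (svec i x2) _]ltNge (ltW e2).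
  have -> : x1 != y by apply: contraTneq e1 => ->; rewrite det_self.
  have -> : x2 != y by apply: contraTneq e2 => ->; rewrite det_self.
  by case: lbefore.
have := Tnc _ _ x1 x2 Txy; rewrite cr => /(_ _) /= -> //; apply: sub.
rewrite /farey_arcs -(norm_det_svec i) s1 s2 det_fan_succ normr1 eqxx /=.
(* Neighbouring boundary points cannot be separated by an arc that ends at neither of them. *)
apply/negP=> seg; move: cr seg x1i x2i.
case: x1 {s1 e1} => [k1|] //; case: x2 {s2 e2} => [k2|] //.
rewrite /crossing /between /=.
case: y {Txy iy sy D0 D1 aDe eD r0 rD t t0 ta e e0 D} => [j|];
  by rewrite !inE ?(inj_eq Some_inj) /=; lia.
Qed.

Lemma bounded_choice (U : Type) (R : nat -> U -> Prop) (u0 : U) n :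
  (forall t, (t < n)%N -> exists x, R t x) ->
  exists f, forall t, (t < n)%N -> R t (f t).
Proof.
elim: n => [|n IH] H; first by exists (fun=> u0).
have [f Rf] := IH (fun t tn => H t (ltnW tn)).
have [x Rx] := H n (ltnSn n).
exists (fun t => if t == n then x else f t) => t tn.
by case: eqP => [-> //|tn']; apply: Rf; lia.
Qed.

Lemma a_gt0 i : 0 < a i.
Proof.
have : 0 < det (v (i - 1)) (v (i + 1)) by apply: v_pos; lia.
have := det_pred_fan i 0; rewrite subr0 /fan mul0r subr0 mul0r subr0.
by rewrite -surjective_pairing => ->.
Qed.

Lemma det_succ_fan i t : det (v (i + 1)) (fan i t) = t.
Proof. by rewrite detC det_fan det_self v_succ; ring. Qed.

(** The indices 0 and [a i] give the boundary neighbours [v (i + 1)] and [- v (i - 1)]; the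
    [a i - 1] indices strictly between give the arcs. *)
Lemma regions_farey_arcs i : regions_at farey_arcs (Some i : pt) (absz (a i)).
Proof.
have a0 := a_gt0 i.
have [|f Rf] := @bounded_choice pt
  (fun t x => x != Some i /\ svec i x = fan i t.+1%:Z) None (absz (a i)).-1.
  by move=> t ta; have [|x xi sx] := @fan_vec i t.+1%:Z; [lia | exists x].
exists (map f (iota 0 (absz (a i)).-1)); split.
- rewrite map_inj_in_uniq ?iota_uniq // => t u; rewrite !mem_iota => ti ui E.
  have [_ st] := Rf t ti; have [_ su] := Rf u ui.
  by have := det_succ_fan i t.+1%:Z; rewrite -st E su det_succ_fan; lia.
- move=> x; apply/mapP/idP => [[t]|/andP[n1 sx]].
    rewrite mem_iota => ti ->; have [fi sf] := Rf t ti.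
    apply/andP; split; first by rewrite /= -det_v_svec sf det_v_fan.
    by apply/negP=> /lsegment_svec; rewrite sf det_succ_fan det_pred_fan; lia.
  have xi : x != Some i.
    by apply: contraTneq n1 => ->; rewrite /= det_self.
  have D1 : det (v i) (svec i x) = 1 by rewrite det_v_svec; apply/eqP.
  have t0 := det_succ_svec xi sx; have ta := det_pred_svec xi sx.
  have E : svec i x = fan i (det (v (i + 1)) (svec i x)).
    by apply: (det_inj (v_succ i)); rewrite ?D1 ?det_v_fan ?det_succ_fan.
  move: t0 ta E; set t := det _ _ => t0 ta E.
  rewrite E det_pred_fan in ta.
  have [|fi sf] := Rf (absz t).-1; first by lia.
  exists (absz t).-1; first by rewrite mem_iota; lia.
  by apply: (@svec_inj i); rewrite sf E; congr fan; lia.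
- by rewrite size_map size_iota; lia.
Qed.

Lemma triangulation_farey_arcs : triangulation farey_arcs.
Proof. split; [exact: noncrossing_farey_arcs | exact: farey_arcs_maximal]. Qed.

End ParabolicFrame.

(** * The vectors of a frieze *)

Fixpoint rec_forward (a : int -> int) (x0 x1 : int) (n : nat) : int * int :=
  if n is n'.+1 then
    let: (x, y) := rec_forward a x0 x1 n' in (y, a n'.+1%:Z * y - x)
  else (x0, x1).

(** After [n] steps the pair holds the values at [- n] and [1 - n]; the forward version holds those
    at [n] and [n + 1]. *)
Fixpoint rec_backward (a : int -> int) (x0 x1 : int) (n : nat) : int * int :=
  if n is n'.+1 then
    let: (x, y) := rec_backward a x0 x1 n' in (a (- n'%:Z) * x - y, x)
  else (x0, x1).

Definition is_solution (a x : int -> int) :=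
  forall i, x (i + 1) = a i * x i - x (i - 1).

Lemma solution_exists (a : int -> int) (x0 x1 : int) :
  exists x, [/\ x 0 = x0, x 1 = x1 & is_solution a x].
Proof.
pose f := rec_forward a x0 x1; pose g := rec_backward a x0 x1.
pose x i := match i with Posz n => (f n).1 | Negz n => (g n.+1).1 end.
have fS n : (f n.+1).1 = (f n).2 by rewrite /f /=; case: rec_forward.
have fS2 n : (f n.+1).2 = a n.+1%:Z * (f n).2 - (f n).1.
  by rewrite /f /=; case: rec_forward.
have gS n : (g n.+1).1 = a (- n%:Z) * (g n).1 - (g n).2.
  by rewrite /g /=; case: rec_backward.
have gS2 n : (g n.+1).2 = (g n).1 by rewrite /g /=; case: rec_backward.
have xg n : x (- n%:Z) = (g n).1 by case: n => // n; rewrite -NegzE.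
exists x; split=> // -[[|n]|n].
- by rewrite (xg 1%N) gS /x add0r /= /rec_forward oppr0; ring.
- have -> : Posz n.+1 + 1 = Posz n.+2 by lia.
  have -> : Posz n.+1 - 1 = Posz n by lia.
  by rewrite /x !fS fS2.
have -> : Negz n + 1 = - n%:Z by lia.
have -> : Negz n - 1 = - n.+2%:Z by lia.
by rewrite NegzE !xg !gS gS2 -NegzE; ring.
Qed.

Lemma solution_unique (a x y : int -> int) :
  is_solution a x -> is_solution a y -> x 0 = y 0 -> x 1 = y 1 -> x =1 y.
Proof.
move=> xa ya e0 e1.
have pos n : x n%:Z = y n%:Z /\ x (n%:Z + 1) = y (n%:Z + 1).
  elim: n => [|n [IH IH1]]; first by [].
  have -> : n.+1%:Z = n%:Z + 1 by lia.
  by split=> //; rewrite xa ya addrK IH IH1.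
have neg n : x (- n%:Z) = y (- n%:Z) /\ x (1 - n%:Z) = y (1 - n%:Z).
  elim: n => [|n [IH IH1]]; first by rewrite subr0 oppr0.
  have -> : 1 - n.+1%:Z = - n%:Z by lia.
  split=> //; have := xa (- n%:Z); have := ya (- n%:Z).
  have -> : - n%:Z + 1 = 1 - n%:Z by lia.
  have -> : - n%:Z - 1 = - n.+1%:Z by lia.
  rewrite IH IH1; lia.
by case=> n; [case: (pos n) | rewrite NegzE; case: (neg n.+1)].
Qed.

Lemma solution_comb (a x y : int -> int) (b c : int) :
  is_solution a x -> is_solution a y ->
  is_solution a (fun i => x i * b + y i * c).
Proof. by move=> xa ya i; rewrite xa ya; ring. Qed.

Lemma shift_invariant (U : Type) (f : int -> U) (p : nat) :
  (forall i, f (i + p%:Z) = f i) -> forall i k, f (i + k * p%:Z) = f i.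
Proof.
move=> fp i; elim/int_rect => [|n IH|n IH]; first by rewrite mul0r addr0.
  by rewrite -IH -[in RHS]fp; congr f; lia.
by rewrite -IH -[in LHS]fp; congr f; lia.
Qed.

Section FriezeFrame.

Variables (m : int -> int -> int) (x y : int -> int).
Hypothesis frieze_m : infinite_frieze m.
Hypotheses (x0 : x 0 = 1) (x1 : x 1 = 0) (y0 : y 0 = 0) (y1 : y 1 = 1).
Hypothesis x_sol : is_solution (fun i => m i i) x.
Hypothesis y_sol : is_solution (fun i => m i i) y.

Definition frame (i : int) : int * int := (x i, y i).

Lemma frame_rec i u :
  det (frame (i + 1)) u = m i i * det (frame i) u - det (frame (i - 1)) u.
Proof. by rewrite /det /frame /= x_sol y_sol; ring. Qed.

Lemma frame_succ i : det (frame i) (frame (i + 1)) = 1.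
Proof.
have step j : det (frame (j + 1)) (frame (j + 1 + 1)) =
              det (frame j) (frame (j + 1)).
  rewrite detC frame_rec addrK.
  by rewrite [det (frame (j + 1)) (frame (j + 1))]det_self; ring.
elim/int_rect: i => [|n IH|n IH].
- by rewrite add0r /det /= x0 x1 y0 y1.
- by rewrite -addn1 PoszD step.
by rewrite -step -[RHS]IH; congr (det (frame _) (frame _)); lia.
Qed.

Lemma frieze_det i j :
  i - 2 <= j -> m i j = det (frame (i - 1)) (frame (j + 1)).
Proof.
have [m0 m1 mpos mdet] := frieze_m.
(* Two adjacent diagonals are carried along, since the unimodular rule expresses each diagonal by
   the two before it. *)
suff E n :
  (forall i, m i (i - 2 + n%:Z) =
             det (frame (i - 1)) (frame (i - 2 + n%:Z + 1))) /\
  (forall i, m i (i - 1 + n%:Z) =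
             det (frame (i - 1)) (frame (i - 1 + n%:Z + 1))).
  move=> ij; have [+ _] := E (absz (j - (i - 2))%R) => /(_ i).
  by have -> : i - 2 + (absz (j - (i - 2))%R)%:Z = j by lia.
elim: n {i j} => [|n [IH IH1]].
  split=> i; rewrite addr0.
    have -> : i - 2 + 1 = i - 1 by lia.
    by rewrite m0 det_self.
  by rewrite m1 frame_succ.
have E i k : i - 2 + k.+1%:Z = i - 1 + k%:Z by lia.
split=> i; first by rewrite E.
case: n IH IH1 E => [|n] IH IH1 E.
  (* On the quiddity row the rule multiplies [m i i] by a zero entry; the value comes from the
     recurrence instead. *)
  have -> : i - 1 + 1%:Z = i by lia.
  rewrite [RHS]detC frame_rec detC.
  have := frame_succ (i - 1); rewrite subrK => ->.
  by rewrite /det; ring.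
have ij : i - 1 <= i - 1 + n.+1%:Z by lia.
have := mdet i (i - 1 + n.+1%:Z) ij.
have := mpos (i + 1) (i - 1 + n.+1%:Z).
rewrite IH1; have := IH (i + 1); have := IH1 (i + 1).
have -> : i + 1 - 2 + n.+1%:Z = i - 1 + n.+1%:Z by lia.
have -> : i + 1 - 1 + n.+1%:Z = i - 1 + n.+1%:Z + 1 by lia.
have -> : i - 1 + n.+2%:Z = i - 1 + n.+1%:Z + 1 by lia.
rewrite addrK => -> -> pos.
set j := i - 1 + n.+1%:Z in ij pos *.
have {}pos : 0 < det (frame i) (frame (j + 1)) by apply: pos; rewrite /j; lia.
have := plucker (frame (i - 1)) (frame i) (frame (j + 1)) (frame (j + 1 + 1)).
rewrite frame_succ; have := frame_succ (i - 1); rewrite subrK => -> P M.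
apply: (mulIf (lt0r_neq0 pos)); move: M; rewrite P mulr1.
by move: (m i _ * _) (det _ _ * _) => r s; lia.
Qed.

Lemma frame_pos i j : i < j -> 0 < det (frame i) (frame j).
Proof.
move=> ij; have [_ _ mpos _] := frieze_m.
have := @frieze_det (i + 1) (j - 1); rewrite addrK subrK => <-; last by lia.
by apply: mpos; lia.
Qed.

(** * The monodromy over a period and its trace *)

Variable p : nat.
Hypothesis p_gt0 : (0 < p)%N.
Hypothesis m_per : forall i, m (i + p%:Z) (i + p%:Z) = m i i.

(** The monodromy matrix has columns [frame p], that is (A, C), and [frame (p + 1)], that is (B,
    D). *)
Let A := x p.
Let B := x (p%:Z + 1).
Let C := y p.
Let D := y (p%:Z + 1).

Lemma shift_solution (z : int -> int) :
  is_solution (fun i => m i i) z ->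
  forall i, z (i + p%:Z) = x i * z p + y i * z (p%:Z + 1).
Proof.
move=> z_sol; apply: (@solution_unique (fun i => m i i)).
- move=> i; have := z_sol (i + p%:Z); rewrite m_per.
  have -> : i + p%:Z + 1 = i + 1 + p%:Z by lia.
  by have -> : i + p%:Z - 1 = i - 1 + p%:Z by lia.
- exact: solution_comb.
- by rewrite x0 y0 add0r; ring.
- by rewrite x1 y1 addrC; ring.
Qed.

Lemma monodromy_det : A * D - B * C = 1.
Proof. by rewrite -(frame_succ p) /det /=; ring. Qed.

(** The entries [m 1 p] and [m 2 (p - 1)] are [D] and [- A]. *)
Lemma trace_growth : m 1 p - m 2 (p%:Z - 1) = A + D.
Proof.
rewrite !frieze_det; [|lia|lia].
have -> : 1 - 1 = 0 :> int by [].
have -> : 2 - 1 = 1 :> int by [].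
by rewrite subrK /det /frame /= x0 x1 y0 y1; rewrite /A /D; ring.
Qed.

Lemma monodromy_gt0 : 0 < C.
Proof. by have := @frame_pos 0 p; rewrite /det /= x0 y0 /C; lia. Qed.

(** By Cayley-Hamilton the lower left entries of the square and cube of the monodromy are [t * C]
    and [(t ^+ 2 - 1) * C], with [t] the trace. Both are frieze entries, so [t > 0] and
    [t ^+ 2 > 1]. *)
Lemma trace_ge2 : 2 <= A + D.
Proof.
have yp : y (p%:Z + p%:Z) = (A + D) * C.
  by rewrite shift_solution // -/A -/B -/C -/D; ring.
have xp : x (p%:Z + p%:Z) = A * A + C * B.
  by rewrite shift_solution // -/A -/B -/C -/D; ring.
have y3 : y (p%:Z + p%:Z + p%:Z) = ((A + D) ^+ 2 - 1) * C.
  by rewrite shift_solution // xp yp -/C -/D -monodromy_det; ring.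
have c0 := monodromy_gt0.
have p2 : 0 < (A + D) * C.
  have := @frame_pos 0 (p%:Z + p%:Z); rewrite /det /= x0 y0 yp; lia.
have p3 : 0 < ((A + D) ^+ 2 - 1) * C.
  have := @frame_pos 0 (p%:Z + p%:Z + p%:Z); rewrite /det /= x0 y0 y3; lia.
move: p2 p3; rewrite !pmulr_lgt0 // expr2; nia.
Qed.

Lemma frame_shift_det i j k :
  det (frame (i + k * p%:Z)) (frame (j + k * p%:Z)) = det (frame i) (frame j).
Proof.
have -> : j = i + (j - i) by lia.
move: (j - i) => d; rewrite -addrA [d + _]addrC addrA.
apply: (@shift_invariant _ (fun i => det (frame i) (frame (i + d)))) => {}i.
rewrite addrAC /det /frame /= !shift_solution //.
by rewrite -[RHS]mul1r -[1 in RHS]monodromy_det /A /B /C /D; ring.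
Qed.

(** * Monodromy of trace 2 *)

Hypothesis parabolic : A + D = 2.

Let BC : B * C = - (A - 1) ^+ 2.
Proof.
have DE : D = 2 - A by lia.
have -> : B * C = A * D - 1 by rewrite -monodromy_det; ring.
by rewrite DE; ring.
Qed.

(** The monodromy minus the identity squares to zero, so its powers grow linearly; (A - 1, C) is the
    first column of that difference. *)
Lemma frame_iter (k : int) :
  x (k * p%:Z) = 1 + k * (A - 1) /\ y (k * p%:Z) = k * C.
Proof.
have DE : D = 2 - A by lia.
elim/int_rect: k => [|n [IHx IHy]|n [IHx IHy]].
- by rewrite !mul0r addr0.
- have -> : n.+1%:Z * p%:Z = n%:Z * p%:Z + p%:Z by lia.
  rewrite !shift_solution // IHx IHy -/A -/B -/C -/D DE -[n.+1]addn1 PoszD.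
  split; last by ring.
  have -> : n%:Z * C * B = n%:Z * (B * C) by ring.
  by rewrite BC; ring.
have E : - n%:Z * p%:Z = - n.+1%:Z * p%:Z + p%:Z by lia.
move: IHx IHy; rewrite E !shift_solution // -/A -/B -/C -/D.
move: (x _) (y _) => X Y IHx IHy.
(* A backward step applies the inverse matrix, with rows (D, - B) and (- C, A). *)
have XE : X = D * (X * A + Y * B) - B * (X * C + Y * D).
  by rewrite -[LHS]mulr1 -monodromy_det; ring.
have YE : Y = A * (X * C + Y * D) - C * (X * A + Y * B).
  by rewrite -[LHS]mulr1 -monodromy_det; ring.
rewrite IHx IHy in XE YE; rewrite XE YE DE -[n.+1]addn1 PoszD.
split; last by ring.
have -> : B * (- n%:Z * C) = - n%:Z * (B * C) by ring.
by rewrite BC; ring.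
Qed.

(* The monodromy fixes the line spanned by [v_p - v_0 = (A - 1, C)]; [w] is the
   primitive vector on it. *)
Let g := gcdz (A - 1) C.

Let g_gt0 : 0 < g.
Proof.
have c0 := monodromy_gt0.
by rewrite /g lt_neqAle eq_sym gcdz_eq0 negb_and (gt_eqF c0) orbT.
Qed.

Let w : int * int := (((A - 1) %/ g)%Z, (C %/ g)%Z).

Let g_w u : g * det u w = u.1 * C - u.2 * (A - 1).
Proof.
rewrite /det /= mulrBr ![g * _]mulrC -!mulrA.
by rewrite !divzK ?dvdz_gcdl ?dvdz_gcdr.
Qed.

Lemma parabolic_primitive : primitive w.
Proof.
have [s [t E]] := Bezoutz (A - 1) C.
exists (- t, s); apply: (mulfI (lt0r_neq0 g_gt0)).
by rewrite detC mulrN g_w mulr1 /= -[RHS]E; ring.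
Qed.

Lemma parabolic_det_gt0 i : 0 < det (frame i) w.
Proof.
have c0 := monodromy_gt0; have gw := g_w (frame i); rewrite /= in gw.
have DE : D = 2 - A by lia.
(* The quadratic form sending a vector to its determinant with its image is degenerate here: [C]
   times it is a square. Positive entries therefore exclude the value 0. *)
have sq : C * det (frame i) (frame (i + p%:Z)) = (g * det (frame i) w) ^+ 2.
  rewrite gw /det /= !shift_solution // -/A -/B -/C -/D DE.
  transitivity (x i ^+ 2 * C ^+ 2 + x i * y i * C * (2 - 2 * A)
                - y i ^+ 2 * (B * C)).
    by ring.
  by rewrite BC; ring.
have d0 : 0 < det (frame i) (frame (i + p%:Z)) by apply: frame_pos; lia.
have w0 : det (frame i) w != 0.
  by apply/eqP => h; have := mulr_gt0 c0 d0; rewrite sq h mulr0.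
rewrite lt_neqAle eq_sym w0 /=; rewrite leNgt; apply/negP => neg.
(* [v_(kp) = v_0 + k g w] would end up on the wrong side of [v_i]. *)
pose k : int := `|i| + `|y i| + 1.
have := @frame_pos i (k * p%:Z).
have [xk yk] := frame_iter k; rewrite /det /= xk yk.
have ik : i < k * p%:Z by rewrite /k; nia.
move=> /(_ ik).
(* The determinant is at most [- k - y i], negative because [k] exceeds [- y i]. *)
have -> : x i * (k * C) - y i * (1 + k * (A - 1)) =
          k * (g * det (frame i) w) - y i.
  by rewrite gw; ring.
have : g * det (frame i) w <= -1.
  by move: g_gt0 neg; move: g (det _ _) => *; nia.
have : 0 < k by lia.
have : - y i < k by lia.
by move: (g * _) (y i) => G Y; nia.
Qed.

Lemma parabolic_shift i k : det (frame (i + k * p%:Z)) w = det (frame i) w.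
Proof.
apply: (@shift_invariant _ (fun i => det (frame i) w)) => {}i.
have DE : D = 2 - A by lia.
apply: (mulfI (lt0r_neq0 g_gt0)).
rewrite !g_w /= !shift_solution // -/A -/B -/C -/D DE.
transitivity (x i * C + y i * (B * C) - y i * (2 - A) * (A - 1)); first by ring.
by rewrite BC; ring.
Qed.

(** The value is affine in [k] with slope [g * det u w], which fixes its sign far out on either
    side. *)
Lemma det_frame_iter u k :
  det u (frame (k * p%:Z)) = det u (1, 0) + k * (g * det u w).
Proof.
by have [xk yk] := frame_iter k; rewrite g_w /det /= xk yk; ring.
Qed.

Lemma frame_right u i : 0 < det u w -> exists2 j, i < j & 0 <= det u (frame j).
Proof.
move=> uw; pose k : int := `|i| + `|det u (1, 0)| + 1.
exists (k * p%:Z); first by rewrite /k; nia.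
rewrite det_frame_iter; have := mulr_gt0 g_gt0 uw.
by rewrite /k; move: (g * _) (det u (1, 0)) => G E; nia.
Qed.

Lemma frame_left u i : 0 < det u w -> exists2 j, j < i & det u (frame j) <= 0.
Proof.
move=> uw; pose k : int := - (`|i| + `|det u (1, 0)| + 1).
exists (k * p%:Z); first by rewrite /k; nia.
rewrite det_frame_iter; have := mulr_gt0 g_gt0 uw.
by rewrite /k; move: (g * _) (det u (1, 0)) => G E; nia.
Qed.

Lemma parabolic_realisable : realisable_in_punctured_disc m.
Proof.
exists p, (@farey_arcs frame w p), (mkseq (fun i => absz (m i i)) p).
split=> //.
- apply: (@triangulation_farey_arcs frame w (fun i => m i i)).
  + exact: frame_rec.
  + exact: frame_pos.
  + exact: frame_succ.
  + exact: parabolic_det_gt0.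
  + exact: parabolic_primitive.
  + exact: frame_shift_det.
  + exact: parabolic_shift.
  + exact: frame_right.
  + exact: frame_left.
- by rewrite size_mkseq.
- move=> i ip; rewrite nth_mkseq //.
  apply: (@regions_farey_arcs frame w (fun i => m i i)).
  + exact: frame_rec.
  + exact: frame_pos.
  + exact: frame_succ.
  + exact: parabolic_det_gt0.
  + exact: parabolic_primitive.
  + exact: frame_right.
  + exact: frame_left.
split; first by rewrite size_mkseq.
exists 0 => i; rewrite size_mkseq subr0.
have [_ _ mpos _] := frieze_m.
have r0 : 0 <= (i %% p%:Z)%Z by apply: modz_ge0; lia.
have rp : (i %% p%:Z)%Z < p%:Z by apply: ltz_pmod.
rewrite nth_mkseq; last by lia.
have -> : Posz (absz (i %% p%:Z)%Z) = (i %% p%:Z)%Z by lia.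
have -> : m i i = m (i %% p%:Z)%Z (i %% p%:Z)%Z.
  rewrite {1 2}(divz_eq i p) addrC.
  by apply: (@shift_invariant _ (fun i => m i i)).
by have := mpos (i %% p%:Z)%Z (i %% p%:Z)%Z; lia.
Qed.

End FriezeFrame.

Theorem corollary3p8 (m : int -> int -> int) (n : nat)
    (frieze_m : infinite_frieze m)
    (period_n : is_minimal_period m n)
    (annulus_m : realisable_in_annulus m)
    (not_disc_m : ~ realisable_in_punctured_disc m) :
  forall k : nat, (0 < k)%N -> 2 < growth_coefficient m n k.
Proof.
move=> k k0; have [[n0 m_per] _] := period_n.
have [x [x0 x1 x_sol]] := solution_exists (fun i => m i i) 1 0.
have [y [y0 y1 y_sol]] := solution_exists (fun i => m i i) 0 1.
pose p := (k * n)%N.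
have p0 : (0 < p)%N by rewrite muln_gt0 k0.
have p_per i : m (i + p%:Z) (i + p%:Z) = m i i.
  rewrite /p PoszM.
  apply: (@shift_invariant _ (fun i => m i i)) => {}i.
  by apply: m_per; lia.
have -> : growth_coefficient m n k = m 1 p - m 2 (p%:Z - 1).
  by rewrite /growth_coefficient; case: k k0 @p {p0 p_per}.
rewrite (trace_growth frieze_m x0 x1 y0 y1 x_sol y_sol p0).
have := trace_ge2 frieze_m x0 x1 y0 y1 x_sol y_sol p0 p_per.
(* Trace exactly 2 would realise the frieze in a disc with [k * n] marked points. *)
rewrite le_eqVlt => /orP[/eqP par|//]; case: not_disc_m.
exact: (parabolic_realisable frieze_m x0 x1 y0 y1 x_sol y_sol p0 p_per
  (esym par)).
Qed.
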